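(* Let $a\in(3/2,5/2]$ and let $\nu$ be a probability measure on $\mathbb Z$ such that (I) the functions $h^\downarrow$ and $h^\uparrow$ are harmonic for $\nu$, and (II) $\nu(-k)\sim p_{\mathbf q}k^{-a}$ as $k\to\infty$, for a constant $p_{\mathbf q}>0$. Let $\ell\ge1$ and $n\ge1$. There exists a coupling, denoted by $\mathbb P^{(1),n}_{\ell,\infty}$, up to time $n$ of the random walk $P_\ell$ under $\mathbb P^{(1)}_\ell$ (started at $1$, conditioned to stay positive until it dies at $-\ell$) and the random walk $P_\infty$ under $\mathbb P^{(1)}_\infty$ (started at $1$, conditioned to stay always positive) such that, under $\mathbb P^{(1),n}_{\ell,\infty}$, for all positive integers $s_1,\dots,s_n$, conditionally on $(P_\infty(k))_{1\le k\le n}=(s_k)_{1\le k\le n}$, the equality $(P_\ell(k))_{1\le k\le n}=(s_k)_{1\le k\le n}$ holds with probability $\frac{1+\ell}{s_n+\ell}$, and $\tau_{-\ell}\le n$ holds with probability $1-\frac{1+\ell}{s_n+\ell}$.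
   Context: $h^\downarrow(\ell)=2^{-2\ell}\binom{2\ell}{\ell}$ for $\ell\ge0$ and $h^\downarrow(\ell)=0$ for $\ell<0$; $h^\uparrow(\ell)=2\ell h^\downarrow(\ell)$ for $\ell\in\mathbb Z$. For $p\ge1$: $h^\downarrow_p(\ell)=h^\downarrow(\ell)h^\downarrow(p)\frac{\ell}{\ell+p}$ for $\ell\ge0$, $h^\downarrow_p(-p)=1$, and $h^\downarrow_p(\ell)=0$ for other $\ell<0$. A function $h$ is harmonic for $\nu$ if $\sum_{k\in\mathbb Z}\nu(k)h(m+k)=h(m)$ for all $m\ge1$. Under (I) and (II), $h^\downarrow_p$ is also harmonic for $\nu$ for every $p\ge1$. Under $\mathbb P^{(1)}_\infty$, $P_\infty$ is the Doob $h^\uparrow$-transform of the random walk with step distribution $\nu$ started at $1$: from $m\ge1$ it jumps to $m+k$ with probability $\nu(k)h^\uparrow(m+k)/h^\uparrow(m)$. Under $\mathbb P^{(1)}_\ell$, $P_\ell$ is the Doob $h^\downarrow_\ell$-transform of the same walk, started at $1$ and absorbed at $-\ell$: from $m\ge1$ it jumps to $m+k$ with probability $\nu(k)h^\downarrow_\ell(m+k)/h^\downarrow_\ell(m)$. $\tau_{-\ell}=\inf\{k\ge0:P_\ell(k)=-\ell\}$. Conditional statements are meant for $(s_k)$ with positive probability. *)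

(* Defs.v *)
From HB Require Import structures.
From mathcomp Require Import all_boot all_order all_algebra.
From mathcomp Require Import all_classical all_reals all_analysis.
Set Implicit Arguments.
Unset Strict Implicit.
Unset Printing Implicit Defensive.
Import Order.TTheory GRing.Theory Num.Theory.
Import numFieldNormedType.Exports.
Local Open Scope classical_set_scope.
Local Open Scope ring_scope.

HB.instance Definition _ := isPointed.Build int (Posz 0).

(* As for [nat] in the library, every subset of [int] is measurable. *)
HB.instance Definition _ := @isMeasurable.Build default_measure_display
  int discrete_measurable discrete_measurable0
  discrete_measurableC discrete_measurableU.

Section renewal_functions.
Context {R : realType}.

Definition hdown (l : int) : R :=
  match l with
  | Posz k => 2 ^- (2 * k)%N * 'C(2 * k, k)%:R
  | Negz _ => 0
  end.

Definition hup (l : int) : R := 2 * l%:~R * hdown l.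

Definition hdownp (p : nat) (l : int) : R :=
  match l with
  | Posz k => hdown k * hdown p * (k%:R / (k + p)%:R)
  | Negz _ => (l == - p%:Z)%:R
  end.

Definition mass (nu : probability int R) (k : int) : R := fine (nu [set k]).

(* Signed, unordered sum over the integers. It is [-oo] when both parts
   diverge, so it is finite exactly when the family is absolutely summable. *)
Definition zsum (f : int -> R) : \bar R :=
  (\esum_(k in [set: int]) (Num.max (f k) 0)%:E
   - \esum_(k in [set: int]) (Num.max (- f k) 0)%:E)%E.

Definition harmonic_for (nu : probability int R) (h : int -> R) : Prop :=
  forall m : int, 1 <= m ->
    zsum (fun k => mass nu k * h (m + k)) = (h m)%:E.

(* One-step probability from [m] to [m'] of the Doob [h]-transform. The states
   [m <= 0] are absorbing: for [h = hdownp l] the only such state that the walk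
   can enter is [- l], and for [h = hup] it can enter none. *)
Definition doob (nu : probability int R) (h : int -> R) (m m' : int) : R :=
  if 1 <= m then mass nu (m' - m) * h m' / h m else (m' == m)%:R.

End renewal_functions.

Section processes.
Context {R : realType} {d : measure_display} {Omega : measurableType d}.
Variable P : probability Omega R.
Implicit Types X : nat -> {RV P >-> int}.

(* [X 0, ..., X n] is a Markov chain with initial state [x0] and transition
   probabilities [q]. Nothing is required of [X k] for [k > n]. *)
Definition markov_upto (n : nat) (x0 : int) (q : int -> int -> R) X : Prop :=
  P [set w | X 0%N w = x0] = 1%E /\
  forall (k : nat) (s : nat -> int), (k < n)%N ->
    P [set w | forall i : nat, (i <= k.+1)%N -> X i w = s i] =
    (P [set w | forall i : nat, (i <= k)%N -> X i w = s i]
     * (q (s k) (s k.+1))%:E)%E.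

Definition path_event (n : nat) X (s : nat -> int) : set Omega :=
  [set w | forall k : nat, (1 <= k <= n)%N -> X k w = s k].

Definition hitting_time X (y : int) (w : Omega) : \bar R :=
  ereal_inf [set (k%:R)%:E | k in [set k : nat | X k w = y]].

Definition cond_prob (A B : set Omega) : R := fine (P (A `&` B)) / fine (P B).

End processes.

(* Main.v *)
Require Import Defs.
From HB Require Import structures.
From mathcomp Require Import all_boot all_order all_algebra.
From mathcomp Require Import all_classical all_reals all_analysis.
From mathcomp Require Import ring lra zify.
Set Implicit Arguments.
Unset Strict Implicit.
Unset Printing Implicit Defensive.
Import Order.TTheory GRing.Theory Num.Theory.
Import numFieldNormedType.Exports.
Local Open Scope classical_set_scope.
Local Open Scope ring_scope.

(* Writing g(r) = hdown(r) / (2 r - 1), one has the exact recursion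
   hdownp (p + 1) j = hdownp p (j + 1) - g(p + 1) * hdown j, which starts from
   hdown at p = 0. So each hdownp p is a finite combination of shifts of hdown
   by nonnegative amounts, and harmonicity of hdown alone makes it harmonic.
   Since hdownp l m / hup m is proportional to 1 / (m + l) for m >= 1, a positive
   path ending at m has, under the first walk, (1 + l) / (m + l) <= 1 times its
   probability under the second. The law of the first walk restricted to
   positive paths is thus a common part C of both laws, and the coupling takes
   C on the diagonal and the two residual measures independently off it. *)

(** * Unordered sums of nonnegative families *)

Section nonnegative_sums.
Context {R : realType}.
Local Open Scope ereal_scope.

Lemma esumZl_le (T : choiceType) (c : R) (a : T -> \bar R) :
  (0 <= c)%R -> (forall t, 0 <= a t) ->
  \esum_(t in [set: T]) (c%:E * a t) <= c%:E * \esum_(t in [set: T]) a t.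
Proof.
move=> c0 a0; apply: ge_ereal_sup => _ [X [finX _] <-].
rewrite -ge0_mule_fsumr//; apply: lee_wpmul2l; first by rewrite lee_fin.
by apply: ereal_sup_ubound; exists X => //; split.
Qed.

(** For [c > 0] the reverse inequality is [esumZl_le] applied to the inverse of [c]. *)
Lemma esumZl (T : choiceType) (c : R) (a : T -> \bar R) :
  (0 <= c)%R -> (forall t, 0 <= a t) ->
  \esum_(t in [set: T]) (c%:E * a t) = c%:E * \esum_(t in [set: T]) a t.
Proof.
rewrite le_eqVlt => /predU1P[<-|c0] a0.
  by rewrite mul0e esum1// => t _; rewrite mul0e.
apply/eqP; rewrite eq_le; apply/andP; split; first exact: esumZl_le (ltW c0) a0.
rewrite -[X in X%:E * esum _ _]invrK lee_pdivrMl ?invr_gt0//.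
have ca0 t : 0 <= c%:E * a t by rewrite mule_ge0// lee_fin ltW.
apply: le_trans (esumZl_le _ ca0); last by rewrite invr_ge0 ltW.
by apply: le_esum => t _; rewrite muleA -EFinM mulVf ?gt_eqF// mul1e.
Qed.

Lemma esum_single (T : choiceType) (t0 : T) (a : T -> \bar R) :
  0 <= a t0 -> (forall t, t != t0 -> a t = 0) -> \esum_(t in [set: T]) a t = a t0.
Proof.
move=> a0 an; rewrite -(esum_set1 a0) [RHS]esum_mkcond; apply: eq_esum => t _.
have [->|tn] := eqVneq t t0; first by rewrite mem_set.
by rewrite an// memNset//= => tt; rewrite tt eqxx in tn.
Qed.

Lemma esum_eq0 (T : choiceType) (a : T -> \bar R) :
  (forall t, 0 <= a t) -> \esum_(t in [set: T]) a t = 0 -> forall t, a t = 0.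
Proof.
move=> a0 aT t; apply/eqP; rewrite eq_le a0 andbT -aT.
rewrite (esumID [set t])// setTI esum_set1// leeDl// esum_ge0//.
Qed.

Lemma esum_pair (T U : choiceType) (a : T * U -> \bar R) :
  (forall p, 0 <= a p) ->
  \esum_(p in [set: T * U]) a p =
  \esum_(t in [set: T]) \esum_(u in [set: U]) a (t, u).
Proof.
move=> a0; rewrite esum_esum//; congr esum; first by apply/seteqP; split=> -[].
by apply/funext => -[].
Qed.

(** Splitting a sequence at its head matches the recursion of the path weights below, so sums over
    paths can be computed by induction. *)
Lemma esum_seq (T : choiceType) (a : seq T -> \bar R) :
  (forall t, 0 <= a t) ->
  \esum_(t in [set: seq T]) a t =
  a [::] + \esum_(x in [set: T]) \esum_(t in [set: seq T]) a (x :: t).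
Proof.
move=> a0; rewrite (esumID [set [::]])// setTI esum_set1//; congr (_ + _).
rewrite -(esum_pair (a := fun p => a (p.1 :: p.2)))// setTI.
apply: (reindex_esum _ _ (fun p : T * seq T => p.1 :: p.2)); split => //.
- by move=> [x1 t1] [x2 t2] _ _ /= [-> ->].
- by move=> [ne|x t _]; [case: ne|exists (x, t)].
Qed.

End nonnegative_sums.

(** * Probability measures with a given mass function *)

Section discrete_probability.
Local Open Scope ereal_scope.

(** An alias that carries the sigma-algebra of all subsets without attaching it to [T] itself; every
    map out of it is measurable. *)
Definition discrete (T : Type) : Type := T.

HB.instance Definition _ (T : pointedType) := Pointed.on (discrete T).
HB.instance Definition _ (T : pointedType) :=
  @isMeasurable.Build default_measure_display (discrete T)
    discrete_measurable discrete_measurable0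
    discrete_measurableC discrete_measurableU.

Context {R : realType} {T : pointedType} (f : T -> R).
Hypothesis f_ge0 : forall t, (0 <= f t)%R.
Hypothesis f_sum1 : \esum_(t in [set: T]) (f t)%:E = 1.

Definition discrete_prob (A : set (discrete T)) : \bar R :=
  \esum_(t in (A : set T)) (f t)%:E.

Let f_ge0E t : 0 <= (f t)%:E. Proof. by rewrite lee_fin. Qed.

Let discrete_prob0 : discrete_prob set0 = 0.
Proof. exact: esum_set0. Qed.

Let discrete_prob_ge0 A : 0 <= discrete_prob A.
Proof. exact: esum_ge0. Qed.

Let discrete_prob_sigma_additive : semi_sigma_additive discrete_prob.
Proof.
move=> F _ tF _; rewrite /discrete_prob nneseries_sum_bigcup//.
by apply: is_cvg_nneseries => n _ _; exact: discrete_prob_ge0.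
Qed.

HB.instance Definition _ := isMeasure.Build _ _ _ discrete_prob
  discrete_prob0 discrete_prob_ge0 discrete_prob_sigma_additive.

Let discrete_probT : discrete_prob setT = 1.
Proof. exact: f_sum1. Qed.

HB.instance Definition _ :=
  Measure_isProbability.Build _ _ _ discrete_prob discrete_probT.

Lemma exists_discrete_prob :
  exists P : probability (discrete T) R,
    forall A, P A = \esum_(t in (A : set T)) (f t)%:E.
Proof. by exists discrete_prob. Qed.

End discrete_probability.

(** * Values and recursions of the renewal functions *)

Section renewal_function_identities.
Context {R : realType}.
Implicit Types (p k : nat) (j m : int).

Lemma hdown_gt0 k : 0 < hdown k :> R.
Proof.
rewrite /hdown mulr_gt0 ?invr_gt0 ?exprn_gt0//.
by rewrite ltr0n bin_gt0 leq_pmull.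
Qed.

Lemma hdown_ge0 j : 0 <= hdown j :> R.
Proof. by case: j => [k|//]; rewrite ltW ?hdown_gt0. Qed.

Lemma hdownS k : hdown k.+1 = (2 * k%:R + 1) / (2 * k%:R + 2) * hdown k :> R.
Proof.
(* Recurrence of the central binomial coefficients, passing from row [2 k] to row [2 k + 2] through
   ['C(2 k + 1, k)]. *)
have bin2S : (k.+1 * 'C(2 * k.+1, k.+1) = 2 * (2 * k).+1 * 'C(2 * k, k))%N.
  have -> : (2 * k.+1 = (2 * k).+2)%N by rewrite mulnS.
  have := mul_bin_down (2 * k).+1 k; rewrite -[(2 * k).+1.-1]/(2 * k)%N.
  rewrite -(mul_bin_diag (2 * k).+2 k) -[(2 * k).+2.-1]/(2 * k).+1.
  have -> : ((2 * k).+1 - k = k.+1)%N by lia.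
  by move: 'C(_.+1, k) 'C(_, k) => x y; nia.
have {}bin2S : (k%:R + 1) * 'C(2 * k.+1, k.+1)%:R =
    2 * (2 * k%:R + 1) * 'C(2 * k, k)%:R :> R.
  move: bin2S; move: 'C(2 * k.+1, k.+1) 'C(2 * k, k) => x y /(congr1 (fun n => n%:R : R)).
  by rewrite !natrM -(natr1 k) -(natr1 (2 * k)) natrM.
have k1 : k%:R + 1 != 0 :> R by rewrite natr1 pnatr_eq0.
rewrite /hdown.
have -> : 2 ^- (2 * k.+1)%N = 2 ^- (2 * k)%N / 4 :> R.
  rewrite mulnS addnC exprD invfM; congr (_ * _); congr (_ ^-1); ring.
apply: (mulfI k1); rewrite mulrCA bin2S; field.
by rewrite expf_neq0//= -[X in _ + X]mulr1 -mulrDr mulf_neq0.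
Qed.

Lemma hup_gt0 m : 1 <= m -> 0 < hup m :> R.
Proof.
case: m => [[//|k]|//] _.
by rewrite /hup mulr_gt0 ?hdown_gt0// mulr_gt0// ltr0z.
Qed.

Lemma hup_ge0 m : 0 <= hup m :> R.
Proof.
by case: m => [k|k]; rewrite /hup/= ?mulr0// !mulr_ge0 ?hdown_ge0 ?ler0z.
Qed.

Lemma hdownpE p m : 1 <= m ->
  hdownp p m = hup m * hdown p / (2 * (m%:~R + p%:R)) :> R.
Proof.
case: m => [[//|k]|//] _; rewrite /hdownp /hup natrD.
have kp : k.+1%:R + p%:R != 0 :> R by rewrite -natrD pnatr_eq0.
have -> : (Posz k.+1)%:~R = k.+1%:R :> R by [].
by field.
Qed.

Lemma hdownp_gt0 p m : 1 <= m -> 0 < hdownp p m :> R.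
Proof.
move=> m1; have m0 : 0 < m%:~R :> R by rewrite ltr0z; exact: lt_le_trans m1.
rewrite hdownpE//; apply: divr_gt0; apply: mulr_gt0 => //.
- exact: hup_gt0.
- exact: hdown_gt0.
- by rewrite ltr_wpDr.
Qed.

Lemma hdownp_ge0 p m : 0 <= hdownp p m :> R.
Proof.
case: m => [k|k]; last by rewrite /hdownp ler0n.
by rewrite !mulr_ge0 ?hdown_ge0// invr_ge0.
Qed.

(** At [0] the factor [k / (k + p)] vanishes, so [- p] is the only possible exit point from the
    positive integers. *)
Lemma hdownp_le0 p m : m <= 0 -> hdownp p m != 0 :> R -> m = - p%:Z.
Proof.
case: m => [[_|//]|k _]; first by rewrite /hdownp mul0r mulr0 eqxx.
by rewrite /hdownp; case: (eqVneq (Negz k) _) => //; rewrite eqxx.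
Qed.

(** Base of the recursion, with [2^-1] as g(1). It is kept apart from the next lemma because
    [hdownp 0] is not [hdown]: at [0] the former is 0, by the convention 0/0 = 0, and the latter is
    1. *)
Lemma hdownp1_shift j :
  hdown (j + 1) = hdownp 1 j + 2^-1 * hdown j :> R.
Proof.
have h1 : hdown 1%N = 2^-1 :> R by rewrite hdownS /hdown/= !bin0 muln0; field.
case: j => [k|[|k]]; last 2 first.
- by rewrite /hdownp/= mulr0 addr0 bin0 muln0 expr0 invr1 mulr1.
- by rewrite /hdownp/= mulr0 addr0.
have -> : Posz k + 1 = k.+1 by rewrite -addn1.
rewrite /hdownp h1 hdownS natrD; field.
by rewrite natr1 pnatr_eq0 -[X in _ + X]mulr1 -mulrDr mulf_neq0 ?pnatr_eq0// natr1 pnatr_eq0.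
Qed.

(** The divisor [2 p + 1] is 2 (p + 1) - 1, so the coefficient is g(p + 1). For [j >= 0] the
    recurrence [hdownS] reduces the claim to a rational identity; for [j < 0] both sides are the
    indicator of [j = - (p + 1)], where [j = -1] needs [p > 0]. *)
Lemma hdownp_shift p j : (0 < p)%N ->
  hdownp p (j + 1) =
  hdownp p.+1 j + hdown p.+1 / (2 * p%:R + 1) * hdown j :> R.
Proof.
move=> p0; case: j => [k|[|k]]; last 2 first.
- rewrite /= mulr0 addr0 mul0r mulr0.
  by case: p p0.
- by rewrite /= mulr0 addr0; congr (nat_of_bool _)%:R; lia.
have -> : Posz k + 1 = k.+1 by rewrite -addn1.
rewrite /hdownp !hdownS !natrD -!natr1.
have p'0 : 0 <= p%:R :> R by [].
have k'0 : 0 <= k%:R :> R by [].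
field.
by do ?[apply/andP; split]; apply: lt0r_neq0; lra.
Qed.

End renewal_function_identities.

(** * Harmonic functions and Doob transforms *)

Section harmonic_functions.
Context {R : realType} (nu : probability int R).
Implicit Types (h : int -> R) (m : int).

Lemma mass_ge0 k : 0 <= mass nu k.
Proof. exact: fine_ge0. Qed.

Lemma zsum_ge0 (f : int -> R) : (forall k, 0 <= f k) ->
  zsum f = \esum_(k in [set: int]) (f k)%:E.
Proof.
move=> f0; rewrite /zsum [X in (_ - X)%E]esum1 ?sube0.
  by apply: eq_esum => k _; rewrite max_l.
by move=> k _; rewrite max_r// oppr_le0.
Qed.

Lemma harmonicP h : (forall k, 0 <= h k) ->
  harmonic_for nu h <-> forall m, 1 <= m ->
    \esum_(k in [set: int]) (mass nu k * h (m + k))%:E = (h m)%:E.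
Proof.
move=> h0; have nuh m k : 0 <= mass nu k * h (m + k) by rewrite mulr_ge0 ?mass_ge0.
by split => H m m1; have := H m m1; rewrite zsum_ge0.
Qed.

(** Harmonicity of [h] at [m + 1], still a positive state, is the equation for [h2 + c * h1] at [m].
    The part of [h1] has the finite sum [c * h1 m], so it can be cancelled in the extended reals. *)
Lemma harmonic_shift_sub h h1 h2 (c : R) : 0 <= c ->
  (forall m, 0 <= h m) -> (forall m, 0 <= h1 m) -> (forall m, 0 <= h2 m) ->
  (forall m, h (m + 1) = h2 m + c * h1 m) ->
  harmonic_for nu h -> harmonic_for nu h1 -> harmonic_for nu h2.
Proof.
move=> c0 h0 h10 h20 hE /harmonicP-/(_ h0) H /harmonicP-/(_ h10) H1.
apply/harmonicP => // m m1.
have /H : 1 <= m + 1 by lia.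
rewrite hE.
have nuh (f : int -> R) k : (forall i, 0 <= f i) -> (0 <= (mass nu k * f (m + k))%:E)%E.
  by move=> f0; rewrite lee_fin mulr_ge0 ?mass_ge0.
under eq_esum => k _.
  rewrite addrAC hE mulrDr mulrCA EFinD (EFinM c); over.
rewrite esumD//; last 2 first.
- by move=> k _; exact: nuh.
- by move=> k _; rewrite mule_ge0 ?nuh.
rewrite esumZl//; last by move=> k; exact: nuh.
rewrite H1// EFinD -EFinM => /(congr1 (fun x => x - (c * h1 m)%:E)%E).
by rewrite !addeK.
Qed.

Lemma hdownp_harmonic p : harmonic_for nu hdown -> (0 < p)%N ->
  harmonic_for nu (hdownp p).
Proof.
move=> H; elim: p => [//|[_ _|p IH _]].
  apply: (harmonic_shift_sub _ _ _ _ hdownp1_shift H H) => //.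
  - exact: hdown_ge0.
  - exact: hdown_ge0.
  - exact: hdownp_ge0.
apply: (harmonic_shift_sub _ _ _ _ (fun m => hdownp_shift m (ltn0Sn p)) (IH isT) H).
- by rewrite divr_ge0 ?hdown_ge0// addr_ge0.
- exact: hdownp_ge0.
- exact: hdown_ge0.
- exact: hdownp_ge0.
Qed.

Lemma doob_ge0 h m m' : (forall k, 0 <= h k) -> 0 <= doob nu h m m'.
Proof.
by move=> h0; rewrite /doob; case: ifP => // _; rewrite divr_ge0 ?mulr_ge0 ?mass_ge0.
Qed.

Lemma doob_sum1 h : (forall k, 0 <= h k) -> (forall m, 1 <= m -> 0 < h m) ->
  harmonic_for nu h ->
  forall m, \esum_(m' in [set: int]) (doob nu h m m')%:E = 1%E.
Proof.
move=> h0 hgt0 /(harmonicP h0) H m; rewrite /doob; case: (boolP (1 <= m)) => m1; last first.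
  rewrite (esum_single (t0 := m))//; first by rewrite eqxx.
  by move=> t /negbTE ->.
(* Passing from the target state to the increment [k] turns the row sum into the harmonicity sum
   divided by [h m]. *)
rewrite (reindex_esum [set: int] _ (fun k => m + k)); last first.
  split=> [//| |y _]; [exact: in2W (addrI m)|exists (y - m) => //].
  by rewrite addrC subrK.
under eq_esum => k _.
  rewrite mulrC -(addrC k m) addrK (addrC k m) EFinM; over.
rewrite esumZl ?invr_ge0 ?h0//; last by move=> k; rewrite lee_fin mulr_ge0 ?mass_ge0 ?h0.
by rewrite H// -EFinM mulVf// gt_eqF// hgt0.
Qed.

End harmonic_functions.

(** * Laws of finite paths of a Markov chain *)

Section path_weights.
Context {R : realType} (q : int -> int -> R).
Implicit Types (n k : nat) (x : int) (t : seq int) (s : nat -> int).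

(** Probability that the chain from [x] makes the [n] steps [t], the start not being stored in [t].
    Sequences of another length get weight 0, so a law on [n]-step paths lives on all of
    [seq int]. *)
Fixpoint path_weight n x t : R :=
  match n, t with
  | 0%N, [::] => 1
  | n'.+1, y :: t' => q x y * path_weight n' y t'
  | _, _ => 0
  end.

Lemma path_weight_size n x t : path_weight n x t != 0 -> size t = n.
Proof.
elim: n x t => [|n IH] x [|y t] //=; rewrite ?eqxx// mulf_eq0 negb_or.
by case/andP => _ /IH ->.
Qed.

Definition cylinder k x s : set (seq int) :=
  [set t | forall i : nat, (i <= k)%N -> nth 0 (x :: t) i = s i].

Lemma cylinder_neq k x s : x != s 0%N -> cylinder k x s = set0.
Proof. by move=> xs; rewrite -subset0 => t /(_ 0%N isT)/= /eqP; apply/negP. Qed.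

Lemma cylinderS k x y s t : x = s 0%N ->
  cylinder k.+1 x s (y :: t) <-> cylinder k y (fun i => s i.+1) t.
Proof.
move=> xs; split => H i ik; first exact: (H i.+1).
by case: i ik => [//|i] ik; exact: (H i).
Qed.

Hypothesis q_ge0 : forall x y, 0 <= q x y.
Hypothesis q_sum1 : forall x, \esum_(y in [set: int]) (q x y)%:E = 1%E.

Lemma path_weight_ge0 n x t : 0 <= path_weight n x t.
Proof. by elim: n x t => [|n IH] x [|y t] //=; rewrite mulr_ge0. Qed.

Lemma path_weight_sum1 n x :
  \esum_(t in [set: seq int]) (path_weight n x t)%:E = 1%E.
Proof.
have w0 m y t : (0 <= (path_weight m y t)%:E)%E by rewrite lee_fin path_weight_ge0.
elim: n x => [|n IH] x; rewrite esum_seq; do ?[by move=> t; exact: w0] => /=.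
  by rewrite esum1 ?adde0// => y _; rewrite esum1.
rewrite add0e -(q_sum1 x); apply: eq_esum => y _.
under eq_esum do rewrite EFinM.
by rewrite esumZl// IH mule1.
Qed.

(** Induction on [k], peeling off the first step: the cylinder keeps only the head [s 1]. The steps
    after time [k] are unconstrained and contribute total mass 1, which is the base case. *)
Lemma path_weight_cylinder n k x s : (k <= n)%N ->
  \esum_(t in cylinder k x s) (path_weight n x t)%:E =
  ((x == s 0%N)%:R * \prod_(i < k) q (s i) (s i.+1))%:E.
Proof.
have w0 m y t : (0 <= (path_weight m y t)%:E)%E by rewrite lee_fin path_weight_ge0.
elim: k n x s => [|k IH] n x s kn; have [xs|xs] := eqVneq x (s 0%N);
  rewrite ?(cylinder_neq _ xs) ?esum_set0 ?mul0r//.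
  rewrite big_ord0 mul1r -(path_weight_sum1 n x); congr esum.
  by apply/seteqP; split => // t _ [|].
case: n kn => [//|n] kn.
rewrite esum_mkcond esum_seq; last by move=> t; case: ifP.
rewrite /= if_same add0e mul1r big_ord_recl.
rewrite (esum_single (t0 := s 1%N)); first last.
- move=> y ys; rewrite esum1// => t _; case: ifPn => // /set_mem/(cylinderS _ _ _ xs).
  by rewrite cylinder_neq.
- by apply: esum_ge0 => t _; case: ifP => // _; rewrite lee_fin mulr_ge0// path_weight_ge0.
rewrite EFinM -xs.
have /(_ n (s 1%N) (fun i => s i.+1) kn) := IH.
rewrite eqxx mul1r => <-; rewrite [in RHS]esum_mkcond -esumZl//; last first.
  by move=> t; case: ifP.
apply: eq_esum => t _.
have -> : (s 1%N :: t \in cylinder k.+1 x s) =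
          (t \in cylinder k (s 1%N) (fun i => s i.+1)).
  by apply/idP/idP => /set_mem/(cylinderS _ _ _ xs) H; rewrite inE.
by case: ifP => _; rewrite ?mule0.
Qed.

(** Only the law of [tail] matters, so this applies to each marginal of a coupling. Cylinder
    probabilities are products of transitions, and one more step adds one factor. *)
Lemma markov_upto_path_weight d (Omega : measurableType d)
    (P : probability Omega R) n x (X : nat -> {RV P >-> int})
    (tail : Omega -> seq int) :
  (forall k w, X k w = nth 0 (x :: tail w) k) ->
  (forall S : set (seq int),
    P [set w | S (tail w)] = \esum_(t in S) (path_weight n x t)%:E) ->
  markov_upto n x q X.
Proof.
move=> XE PE.
have cylE k s : [set w | forall i : nat, (i <= k)%N -> X i w = s i] =
    [set w | cylinder k x s (tail w)].
  by apply/seteqP; split => w H i /H; rewrite XE.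
split=> [|k s kn].
  rewrite [X in P X](_ : _ = setT) ?probability_setT//.
  by apply/seteqP; split => // w _ /=; rewrite XE.
rewrite !cylE !PE !path_weight_cylinder ?(ltnW kn)//.
by rewrite big_ord_recr -EFinM mulrA.
Qed.

End path_weights.

(** Along positive states the factors [h z / h y] of the transform telescope to
    [h (last x t) / h x]. *)
Lemma path_weight_doob (R : realType) (nu : probability int R) (h : int -> R)
    (n : nat) (x : int) (t : seq int) :
  (forall m, 1 <= m -> 0 < h m) -> all (fun y => 1 <= y) (x :: t) ->
  path_weight (doob nu h) n x t * h x =
  path_weight (fun y z => mass nu (z - y)) n x t * h (last x t).
Proof.
move=> h0; elim: n x t => [|n IH] x [|y t]; rewrite ?mul0r//.
rewrite /= => /and3P[x1 y1 t1]; rewrite -[RHS]mulrA -IH/= ?y1//.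
rewrite {1}/doob x1; field.
by rewrite gt_eqF ?h0.
Qed.

(** * Coupling two laws along a common part *)

Section common_part_coupling.
Context {R : realType} {T : choiceType}.
Implicit Types A B C : T -> R.

(* When [\sum C = 1] the division by zero gives [0], which is the right value
   because then [A = B = C]. *)
Definition coupling A B C (p : T * T) : R :=
  C p.1 * (p.1 == p.2)%:R +
  (A p.1 - C p.1) * (B p.2 - C p.2) /
    (1 - fine (\esum_(t in [set: T]) (C t)%:E)).

(** This symmetry yields the second marginal from the first. *)
Lemma coupling_swap A B C t u : coupling A B C (t, u) = coupling B A C (u, t).
Proof.
rewrite /coupling/= [X in X / _]mulrC eq_sym.
by case: eqVneq => [->//|_]; rewrite !mulr0.
Qed.

Section laws.
Variables A B C : T -> R.
Hypotheses (C_ge0 : forall t, 0 <= C t)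
  (CA : forall t, C t <= A t) (CB : forall t, C t <= B t)
  (A_sum1 : \esum_(t in [set: T]) (A t)%:E = 1%E)
  (B_sum1 : \esum_(t in [set: T]) (B t)%:E = 1%E).

Lemma residual_sum (A' : T -> R) : (forall t, C t <= A' t) ->
  \esum_(t in [set: T]) (A' t)%:E = 1%E ->
  \esum_(t in [set: T]) (A' t - C t)%:E =
  (1 - fine (\esum_(t in [set: T]) (C t)%:E))%:E.
Proof.
move=> CA' A'1.
have Cfin : \esum_(t in [set: T]) (C t)%:E \is a fin_num.
  rewrite ge0_fin_numE; last by apply: esum_ge0 => t _; rewrite lee_fin.
  apply: le_lt_trans (ltry 1); rewrite -A'1.
  by apply: le_esum => t _; rewrite lee_fin.
rewrite EFinB fineK//.
have <- : (\esum_(t in [set: T]) (A' t - C t)%:E +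
    \esum_(t in [set: T]) (C t)%:E)%E = 1%E.
  rewrite -esumD => [|t _|t _]; rewrite ?lee_fin ?subr_ge0// -A'1.
  by apply: eq_esum => t _; rewrite -EFinD subrK.
by rewrite addeK.
Qed.

Lemma residual_ge0 : 0 <= 1 - fine (\esum_(t in [set: T]) (C t)%:E).
Proof.
rewrite -lee_fin -(residual_sum CA A_sum1).
by apply: esum_ge0 => t _; rewrite lee_fin subr_ge0.
Qed.

Lemma coupling_ge0 p : 0 <= coupling A B C p.
Proof.
apply: addr_ge0; first by rewrite mulr_ge0.
by apply: divr_ge0 residual_ge0; rewrite mulr_ge0 ?subr_ge0.
Qed.

(** The diagonal contributes [C t]; in the product term the residuals of [B] sum to [D], which
    cancels the division and leaves [A t - C t]. *)
Lemma coupling_lawl t :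
  \esum_(u in [set: T]) (coupling A B C (t, u))%:E = (A t)%:E.
Proof.
rewrite /coupling/=; set D := 1 - _.
have D0 : 0 <= D := residual_ge0.
under eq_esum do rewrite mulrAC EFinD (EFinM (_ / D)).
have AC0 : 0 <= (A t - C t) / D by apply: divr_ge0 => //; rewrite subr_ge0.
have BC0 u : (0 <= (B u - C u)%:E)%E by rewrite lee_fin subr_ge0.
rewrite esumD; first last.
- by move=> u _; rewrite mule_ge0.
- by move=> u _; rewrite lee_fin mulr_ge0.
rewrite esumZl// residual_sum// -/D.
rewrite (esum_single (t0 := t)) ?eqxx ?mulr1 ?lee_fin//; last first.
  by move=> u; rewrite eq_sym => /negbTE ->; rewrite mulr0.
rewrite -EFinM -EFinD; congr EFin.
(* If [D = 0], the product term is 0, and the residuals of [A], being nonnegative with sum 0, vanish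
   pointwise. *)
have [D00|D00] := eqVneq D 0; last by field.
have := residual_sum CA A_sum1; rewrite -/D D00 => /esum_eq0-/(_ _ t).
rewrite mulr0 addr0 => H.
by apply/esym/eqP; rewrite -subr_eq0 -eqe H// => u; rewrite lee_fin subr_ge0.
Qed.

End laws.
End common_part_coupling.

(** * Marginal events, hitting times and random variables *)

Lemma esum_fst (R : realType) (T U : choiceType) (f : T * U -> R) (g : T -> R)
    (S : set T) :
  (forall p, 0 <= f p) ->
  (forall t, \esum_(u in [set: U]) (f (t, u))%:E = (g t)%:E) ->
  \esum_(p in [set p | S p.1]) (f p)%:E = \esum_(t in S) (g t)%:E.
Proof.
move=> f0 fg; rewrite esum_mkcond esum_pair; last by move=> p; case: ifP; rewrite ?lee_fin.
rewrite [RHS]esum_mkcond; apply: eq_esum => t _.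
case: (boolP (t \in S)) => tS.
  by rewrite -fg; apply: eq_esum => u _; rewrite mem_set// ; exact: set_mem.
by rewrite esum1// => u _; rewrite memNset//= => /mem_set; apply/negP.
Qed.

Lemma esum_snd (R : realType) (T U : choiceType) (f : T * U -> R) (g : U -> R)
    (S : set U) :
  (forall p, 0 <= f p) ->
  (forall u, \esum_(t in [set: T]) (f (t, u))%:E = (g u)%:E) ->
  \esum_(p in [set p | S p.2]) (f p)%:E = \esum_(u in S) (g u)%:E.
Proof.
move=> f0 fg; rewrite -(esum_fst (f := fun p => f (p.2, p.1)))//.
apply: (reindex_esum _ _ (fun p : U * T => (p.2, p.1))); split => //.
- by move=> [? ?] [? ?] _ _ [-> ->].
- by move=> [x y] Sy; exists (y, x).
Qed.

Lemma hitting_time_le (R : realType) d (Omega : measurableType d)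
    (P : probability Omega R) (X : nat -> {RV P >-> int}) (y : int) (n : nat)
    (w : Omega) :
  (hitting_time X y w <= (n%:R)%:E)%E <-> exists2 k, (k <= n)%N & X k w = y.
Proof.
split=> [H|[k kn Xk]]; last first.
  apply: le_trans (_ : (k%:R)%:E <= _)%E; last by rewrite lee_fin ler_nat.
  by apply: ereal_inf_lbound; exists k.
apply: contrapT => nhit; move: H; apply/negP; rewrite -ltNge.
(* Without a visit up to time [n], [n + 1] is a lower bound of all visit times, even when there are
   none and the infimum is [+oo]. *)
apply: lt_le_trans (_ : (n.+1%:R)%:E <= _)%E; first by rewrite lte_fin ltr_nat.
apply: le_ereal_inf_tmp => _ [k Xk <-]; rewrite lee_fin ler_nat ltnNge.
by apply/negP => kn; apply: nhit; exists k.
Qed.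

Lemma exists_rv (R : realType) (T : pointedType)
    (P : probability (discrete T) R) (f : nat -> T -> int) :
  exists X : nat -> {RV P >-> int}, forall k w, X k w = f k w.
Proof.
have mf k : measurable_fun [set: discrete T] (f k : discrete T -> int) by [].
pose X k : {RV P >-> int} :=
  HB.pack (f k : discrete T -> int) (isMeasurableFun.Build _ _ _ _ _ (mf k)).
by exists X.
Qed.

(** * Paths under the two conditioned walks *)

Lemma path_weight_ratio (R : realType) (nu : probability int R) (l n : nat)
    (t : seq int) : all (fun y => 1 <= y) t ->
  path_weight (doob nu (hdownp l)) n 1 t =
  path_weight (doob nu hup) n 1 t * ((1 + l%:R) / ((last 1 t)%:~R + l%:R)).
Proof.
move=> tpos.
have xpos : all (fun y => 1 <= y) (1 :: t) by rewrite /= tpos.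
have last1 : 1 <= last 1 t by exact: (allP xpos) (mem_last 1 t).
have UE := path_weight_doob nu n (@hdownp_gt0 R l) xpos.
have WE := path_weight_doob nu n (@hup_gt0 R) xpos.
move: UE WE; rewrite !hdownpE//.
have last0 : 1 <= (last 1 t)%:~R :> R by rewrite ler1z.
have h10 := @hup_gt0 R 1 (lexx _).
have hl0 : 0 < hdown l :> R := hdown_gt0 l.
have L0 : 0 <= l%:R :> R by [].
have -> : (1 : int)%:~R = 1 :> R by [].
set U := path_weight (doob nu (hdownp l)) n 1 t.
set W := path_weight (doob nu hup) n 1 t.
set V := path_weight _ _ _ _.
set h1 := hup 1 in h10 *; set hl := hdown l in hl0 *.
set hm := hup _; set m := _%:~R in last0 *; set L := l%:R in L0 *.
move=> UE WE.
apply: (mulIf (lt0r_neq0 h10)); apply: (mulIf (lt0r_neq0 hl0)).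
have L1 : 1 + L != 0 by apply: lt0r_neq0; lra.
have mL : m + L != 0 by apply: lt0r_neq0; lra.
(* The inserted factor is [hdownp l 1]; both weights are compared with the weight [V] of the same
   path under the unconditioned walk. *)
transitivity (U * (h1 * hl / (2 * (1 + L))) * (2 * (1 + L))); first by field.
rewrite UE.
transitivity (V * hm * hl * ((1 + L) / (m + L))); first by field.
by rewrite -WE; field.
Qed.

(* A path of positive weight is absorbed in [- l] as soon as it leaves the
   positive integers, since [hdownp l] vanishes at the other such points. *)
Lemma path_weight_absorbed (R : realType) (nu : probability int R) (l n : nat)
    (x : int) (t : seq int) :
  1 <= x -> ~~ all (fun y => 1 <= y) t ->
  path_weight (doob nu (hdownp l)) n x t != 0 -> - l%:Z \in t.
Proof.
elim: n x t => [|n IH] x [|y t] //=; rewrite ?eqxx//.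
move=> x1; rewrite negb_and mulf_eq0 negb_or inE => yt /andP[dxy wt].
have [y1|y1] := boolP (1 <= y).
  by rewrite (IH y) ?orbT//; move: yt; rewrite y1.
(* First step out of the positive integers: a nonzero transition requires [hdownp l y != 0]. *)
move: dxy; rewrite /doob x1 !mulf_eq0 !negb_or -andbA => /and3P[_ /hdownp_le0 yE _].
by rewrite yE ?eqxx//; lia.
Qed.

(** Time [k] sits at index [k - 1] of [t], whence [s i.+1]. Fixing the size excludes longer
    sequences with the same first [n] entries. *)
Lemma path_mkseqP (s : nat -> int) (n : nat) (t : seq int) : size t = n ->
  (forall k : nat, (1 <= k <= n)%N -> nth 0 (1 :: t) k = s k) <->
  t = mkseq (fun i => s i.+1) n.
Proof.
move=> tn; split=> [H|-> k]; last by case: k => [//|k] /= kn; rewrite nth_mkseq.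
apply: (@eq_from_nth _ 0) => [|i]; first by rewrite size_mkseq.
by rewrite tn => i_lt_n; rewrite nth_mkseq// -H.
Qed.

(** * Construction of the coupled walks *)

HB.instance Definition _ (T : choiceType) := isPointed.Build (seq T) [::].

Theorem lemma2p5 (R : realType) (a : R) (nu : probability int R) (pq : R)
  (l n : nat)
  (ha : 3 / 2 < a <= 5 / 2)
  (hdown_harmonic : harmonic_for nu hdown)
  (hup_harmonic : harmonic_for nu hup)
  (hpq : 0 < pq)
  (nu_tail : (fun k : nat => mass nu (- k%:Z) : R^o) ~_\oo
             (fun k : nat => pq * k%:R `^ (- a) : R^o))
  (hl : (1 <= l)%N) (hn : (1 <= n)%N) :
  exists (d : measure_display) (Omega : measurableType d)
         (P : probability Omega R) (Pl Pinf : nat -> {RV P >-> int}),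
    markov_upto n 1 (doob nu (hdownp l)) Pl /\
    markov_upto n 1 (doob nu hup) Pinf /\
    forall s : nat -> int,
      (forall k : nat, (1 <= k <= n)%N -> 0 < s k) ->
      (0 < P (path_event n Pinf s))%E ->
      let r : R := (1 + l%:R) / ((s n)%:~R + l%:R) in
      cond_prob P (path_event n Pl s) (path_event n Pinf s) = r /\
      cond_prob P [set w | (hitting_time Pl (- l%:Z) w <= (n%:R)%:E)%E]
                  (path_event n Pinf s) = 1 - r.
Proof.
pose ql := doob nu (hdownp l); pose qi := doob nu hup.
have ql0 x y : 0 <= ql x y by apply: doob_ge0 => ?; exact: hdownp_ge0.
have qi0 x y : 0 <= qi x y by apply: doob_ge0 => ?; exact: hup_ge0.
have ql1 := doob_sum1 (hdownp_ge0 l) (@hdownp_gt0 R l)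
  (hdownp_harmonic hdown_harmonic hl).
have qi1 := doob_sum1 hup_ge0 (@hup_gt0 R) hup_harmonic.
(* [A] is the path law of [Pinf] and [B] that of [Pl]; accordingly the first coordinate of the
   coupling drives [Pinf] and the second [Pl]. *)
pose A := path_weight qi n 1; pose B := path_weight ql n 1.
have A0 t : 0 <= A t by exact: path_weight_ge0.
have B0 t : 0 <= B t by exact: path_weight_ge0.
pose C (t : seq int) : R := if all (fun y => 1 <= y) t then B t else 0.
have C0 t : 0 <= C t by rewrite /C; case: ifP.
have CB t : C t <= B t by rewrite /C; case: ifP.
have CA t : C t <= A t.
  rewrite /C; case: ifPn => // tpos; rewrite /B /ql path_weight_ratio//.
  rewrite ler_piMr ?A0//.
  have last1 : 1 <= (last 1 t)%:~R :> R.
    by rewrite ler1z; apply: (allP (_ : all _ (1 :: t))) (mem_last 1 t).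
  have l0 : 0 <= l%:R :> R by [].
  by rewrite ler_pdivrMr; lra.
have A1 : \esum_(t in [set: seq int]) (A t)%:E = 1%E by exact: path_weight_sum1.
have B1 : \esum_(t in [set: seq int]) (B t)%:E = 1%E by exact: path_weight_sum1.
pose J : seq int * seq int -> R := coupling A B C.
have J0 p : 0 <= J p by exact: coupling_ge0.
have J0E p : (0 <= (J p)%:E)%E by rewrite lee_fin.
have JA t : \esum_(u in [set: seq int]) (J (t, u))%:E = (A t)%:E.
  exact: coupling_lawl.
have JB u : \esum_(t in [set: seq int]) (J (t, u))%:E = (B u)%:E.
  by under eq_esum do rewrite /J coupling_swap; exact: coupling_lawl.
have J1 : \esum_(p in [set: seq int * seq int]) (J p)%:E = 1%E.
  by rewrite esum_pair// -A1; apply: eq_esum => t _; exact: JA.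
pose T : pointedType := (seq int * seq int)%type.
have [P PE] := @exists_discrete_prob R T J J0 J1.
have [Pl PlE] := exists_rv P (fun k (p : T) => nth 0 (1 :: p.2) k).
have [Pinf PinfE] := exists_rv P (fun k (p : T) => nth 0 (1 :: p.1) k).
exists default_measure_display, (discrete T), P, Pl, Pinf.
split.
  apply: (markov_upto_path_weight ql0 ql1 PlE) => S.
  by rewrite PE (esum_snd _ J0 JB).
split.
  apply: (markov_upto_path_weight qi0 qi1 PinfE) => S.
  by rewrite PE (esum_fst _ J0 JA).
move=> s spos Ps r.
pose sl := mkseq (fun i => s i.+1) n.
have slpos : all (fun y => 1 <= y) sl.
  by apply/(all_nthP 0) => i; rewrite size_mkseq => iN; rewrite nth_mkseq// -gtz0_ge1 spos.
have Csl : C sl = A sl * r.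
  rewrite /C slpos /B /ql path_weight_ratio//; congr (_ * (_ / (_%:~R + _))).
  rewrite (last_nth 0) size_mkseq.
  (* Taken at time [n]; since [n >= 1], the last entry is [s n] and not merely the starting
     point. *)
  by apply: (path_mkseqP s (size_mkseq _ n)).2; rewrite // hn leqnn.
(* A zero of a marginal forces zeros of [J], and both marginals charge only paths of length [n]. *)
have J_support p : J p != 0 -> size p.1 = n /\ size p.2 = n.
  case: p => t u Jtu; split.
    apply: (@path_weight_size _ qi n 1); apply: contra_neq Jtu => At.
    apply: EFin_inj; apply: (esum_eq0 (a := fun u => (J (t, u))%:E)) => //.
    by rewrite JA; congr EFin.
  apply: (@path_weight_size _ ql n 1); apply: contra_neq Jtu => Bu.
  apply: EFin_inj; apply: (esum_eq0 (a := fun t => (J (t, u))%:E)) => //.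
  by rewrite JB; congr EFin.
pose EI := path_event n Pinf s; pose EL := path_event n Pl s.
pose EH := [set w | (hitting_time Pl (- l%:Z) w <= (n%:R)%:E)%E].
have EIP p : size p.1 = n -> EI p <-> p.1 = sl.
  move=> pn; rewrite -(path_mkseqP s pn).
  by split => H k /H; rewrite PinfE.
have ELP p : size p.2 = n -> EL p <-> p.2 = sl.
  move=> pn; rewrite -(path_mkseqP s pn).
  by split => H k /H; rewrite PlE.
have PEI : P EI = (A sl)%:E.
  (* [EI] depends on the first coordinate only; [[::]] is a dummy second one. *)
  have -> : EI = [set p | [set t | EI (t, [::])] p.1].
    by apply/seteqP; split => p H k /H; rewrite !PinfE.
  rewrite PE (esum_fst _ J0 JA) esum_mkcond (esum_single (t0 := sl)).
  - by rewrite mem_set//; apply/EIP => //=; rewrite size_mkseq.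
  - by case: ifP; rewrite ?lee_fin.
  - move=> t tsl; case: ifPn => // /set_mem/= tEI.
    congr EFin; apply/eqP; apply: contraNT tsl => At.
    by apply/eqP/(EIP (t, [::])) => //=; exact: path_weight_size At.
(* Only the diagonal point [(sl, sl)] counts. Its product term vanishes because [C] equals [B] on
   positive paths. *)
have PEL : P (EL `&` EI) = (C sl)%:E.
  rewrite PE esum_mkcond (esum_single (t0 := (sl, sl))).
  - rewrite mem_set; last by split; [apply/ELP|apply/EIP]; rewrite //= size_mkseq.
    rewrite /J /coupling/= eqxx mulr1 [B sl - _](_ : _ = 0).
      by rewrite mulr0 mul0r addr0.
    by rewrite /C slpos subrr.
  - by case: ifP.
  - move=> p psl; case: ifPn => // /set_mem[pEL pEI].
    congr EFin; apply/eqP; apply: contraNT psl => /J_support[p1 p2].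
    by rewrite [p]surjective_pairing (EIP p p1).1// (ELP p p2).1.
(* On the support of [J] inside [EI], exactly one of [EH] and [EL] occurs: either [Pl] follows [sl],
   which stays positive, or it hits [- l]. *)
have PEH : (P (EH `&` EI) + P (EL `&` EI) = P EI)%E.
  rewrite !PE !(esum_mkcond (_ `&` _)) (esum_mkcond EI) -esumD; first last.
  - by move=> p _; case: ifP.
  - by move=> p _; case: ifP.
  apply: eq_esum => p _.
  have [->|Jp] := eqVneq (J p) 0; first by rewrite !if_same adde0.
  have [p1 p2] := J_support p Jp.
  rewrite !in_setI; case: (boolP (p \in EI)) => pEI; last by rewrite !andbF adde0.
  have {}pEI : p.1 = sl by apply/EIP => //; exact: set_mem.
  rewrite !andbT; have [p2sl|p2sl] := eqVneq p.2 sl.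
    rewrite (mem_set (_ : EL p)); last exact/ELP.
    rewrite memNset ?add0e// => /hitting_time_le[[|k] kn]; rewrite PlE ?p2sl/=.
      by move=> /eqP; lia.
    by rewrite nth_mkseq// => sk; have := spos k.+1 kn; rewrite sk; lia.
  rewrite [p \in EL]memNset ?adde0; last by move/ELP => /(_ p2)/eqP; apply/negP.
  rewrite mem_set//; apply/hitting_time_le.
  (* Off the diagonal only the product term remains, and its factor [B - C] is 0 on positive paths.
     So [p.2] leaves the positive integers with positive weight and is absorbed. *)
  have /(nthP 0)[k kn kl] : - l%:Z \in p.2.
    apply: (@path_weight_absorbed R nu l n 1) => //.
      apply: contra_neqN Jp => ppos; rewrite /J /coupling pEI eq_sym (negbTE p2sl).
      by rewrite /C ppos subrr !mulr0 mul0r addr0.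
    apply: contra_neq Jp => Bp.
    have Cp : C p.2 = 0 by rewrite /C /B Bp if_same.
    rewrite /J /coupling pEI eq_sym (negbTE p2sl) Cp /B Bp.
    by rewrite subrr !mulr0 mul0r addr0.
  by exists k.+1; [rewrite -p2|rewrite PlE].
(* Positivity of the conditioning event makes the divisions in [cond_prob] genuine. *)
have Asl : A sl != 0 by move: Ps; rewrite -/EI PEI lte_fin => /lt0r_neq0.
rewrite /cond_prob -/EI -/EL -/EH PEI PEL /= Csl; split; first by field.
have -> : P (EH `&` EI) = (A sl - A sl * r)%:E.
  by rewrite EFinB -PEI -PEH PEL -Csl addeK.
by rewrite /=; field.
Qed.
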